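(* Let $f:P\times X\to Y$ be a $K$-convex and $K$-closed map, let $C:P\rightrightarrows X$ be a closed and convex set-valued map, let $(\bar p,\bar x)\in \mathrm{gph}\,\mathcal S$ and $\bar y=f(\bar p,\bar x)$. Let $H:P\rightrightarrows P\times X$ be defined by $H(p)=\{p\}\times C(p)$. Suppose that (i) $\mathbb{R}^+(\mathrm{rge}\,H-\mathrm{dom}\,f)$ is a closed subspace of $P\times X$; (ii) $\mathbb{R}^+(P-\mathrm{dom}\,C)$ is a closed subspace of $P$. Then, for every $y^*\in Y^*$, $$D^*(F+K)(\bar p,\bar y)(y^* )=\bigcup_{(p^*,x^* )\in D^*(f+K)(\bar p,\bar x)(y^* )}\Big\{p^*+D^*C(\bar p,\bar x)(x^* )\Big\}.$$ In particular, for every $y^*\in K^*$, $$D^*(F+K)(\bar p,\bar y)(y^* )=\bigcup_{(p^*,x^* )\in \partial\langle y^*,f\rangle(\bar p,\bar x)}\Big\{p^*+D^*C(\bar p,\bar x)(x^* )\Big\}.$$ Moreover, if $f$ is continuously differentiable at $(\bar p,\bar x)$, then for every $y^*\in K^*$, $$D^*(F+K)(\bar p,\bar y)(y^* )=\nabla_p f(\bar p,\bar x)^*(y^* )+D^*C(\bar p,\bar x)\big(\nabla_x f(\bar p,\bar x)^*(y^* )\big).$$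
   Context: $X,Y,P$ are Banach spaces with duals $X^*,Y^*,P^*$; products carry the norm $\|(x,y)\|=\|x\|+\|y\|$. $K\subseteq Y$ is a pointed, closed, convex cone with apex at the origin, and $K^*=\{y^*\in Y^*\mid \langle y^*,k\rangle\ge 0\ \forall k\in K\}$. For a set $\Omega$, $\mathbb{R}^+(\Omega)=\mathrm{cone}\,\Omega=\{\lambda a\mid \lambda\ge 0,\ a\in\Omega\}$. For a set-valued map $G:U\rightrightarrows V$ between Banach spaces: $\mathrm{dom}\,G=\{u\mid G(u)\ne\emptyset\}$, $\mathrm{gph}\,G=\{(u,v)\mid v\in G(u)\}$, $\mathrm{rge}\,G=\bigcup_{u\in U}G(u)$. $G$ is convex (closed) if $\mathrm{gph}\,G$ is convex (closed). If $V=Y$, $\mathrm{epi}\,G=\{(u,y)\mid y\in G(u)+K\}$, $G$ is $K$-convex ($K$-closed) if $\mathrm{epi}\,G$ is convex (closed), and the profile map is $(G+K)(u)=G(u)+K$, so that $\mathrm{gph}(G+K)=\mathrm{epi}\,G$. All set-valued maps are assumed proper (nonempty domain). A single-valued map is regarded as the set-valued map with singleton values. For a convex set-valued map $G$ and $(\bar u,\bar v)\in\mathrm{gph}\,G$, the coderivative is $D^*G(\bar u,\bar v)(v^* )=\{u^*\in U^*\mid (u^*,-v^* )\in N((\bar u,\bar v),\mathrm{gph}\,G)\}$ for $v^*\in V^*$, where for a convex set $\Omega$ and $\bar w\in\Omega$, $N(\bar w,\Omega)=\{w^*\mid \langle w^*,w-\bar w\rangle\le 0\ \forall w\in\Omega\}$.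 $D^*(f+K)(\bar p,\bar x)$ denotes the coderivative of $f+K$ at the point $((\bar p,\bar x),f(\bar p,\bar x))$. $\partial$ is the subdifferential of convex analysis and $\langle y^*,f\rangle(p,x)=\langle y^*,f(p,x)\rangle$. $\nabla_pf(\bar p,\bar x)^*$ and $\nabla_xf(\bar p,\bar x)^*$ are the adjoints of the partial derivatives. $F:P\rightrightarrows Y$ is the objective map $F(p)=\{y\in Y\mid \exists x\in C(p),\ y=f(p,x)\}$. For nonempty $A\subseteq Y$, $\mathrm{Min}_KA=\{a\in A\mid (A-a)\cap(-K\setminus\{0\})=\emptyset\}$. $\mathcal F(p)=\mathrm{Min}_KF(p)$ is the perturbation map and $\mathcal S(p)=\{x\in C(p)\mid f(p,x)\in\mathcal F(p)\}$ is the solution map. *)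

(* Defs.v *)
From HB Require Import structures.
From mathcomp Require Import all_boot all_order all_algebra.
From mathcomp Require Import all_classical all_reals all_analysis.

Set Implicit Arguments.
Unset Strict Implicit.
Unset Printing Implicit Defensive.

Import Order.TTheory GRing.Theory Num.Theory.
Import numFieldNormedType.Exports.

Local Open Scope classical_set_scope.
Local Open Scope ring_scope.

(* Products of normed spaces carry the library's max norm; it is equivalent to
   the sum norm, and only topological notions (closedness, dual spaces, Frechet
   derivatives and their continuity) are taken on products. *)

Section SetOperations.
Context {R : realType} {V : lmodType R}.
Implicit Types A B : set V.

Definition set_add A B : set V := [set a + b | a in A & b in B].
Definition set_opp A : set V := [set - a | a in A].
Definition set_sub A B : set V := [set a - b | a in A & b in B].

Definition cone A : set V := [set v | exists l a, [/\ 0 <= l, A a & v = l *: a]].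

End SetOperations.

Section Cones.
Context {R : realType} {Y : normedModType R}.
Implicit Types K A : set Y.

Definition closed_subspace A := submod_closed [in A] /\ closed A.

Definition pointed_closed_convex_cone K :=
  [/\ K !=set0, (forall l k, 0 <= l -> K k -> K (l *: k)),
      convex_set (K : set (convex_lmodType Y)), closed K &
      K `&` set_opp K = [set 0]].

(* Min_K A *)
Definition minimal_points K A : set Y :=
  [set a | A a /\ set_sub A [set a] `&` (set_opp K `\ 0) = set0].

End Cones.

Section Duality.
Context {R : realType}.

(* The topological dual, as a set of functions. *)
Definition dual (V : normedModType R) : set (V -> R^o) :=
  [set l | linear l /\ continuous l].

Definition dual_cone (Y : normedModType R) (K : set Y) : set (Y -> R^o) :=
  [set l | dual l /\ forall k, K k -> 0 <= l k].

(* The functional on a product given by a pair of functionals: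
   <(us, vs), (u, v)> = <us, u> + <vs, v>. *)
Definition pair_functional (U V : normedModType R)
    (us : U -> R^o) (vs : V -> R^o) : U * V -> R^o :=
  fun w => us w.1 + vs w.2.

(* A set of functionals on U * V, seen in U^* x V^*. *)
Definition as_pairs (U V : normedModType R) (D : set (U * V -> R^o)) :
    set ((U -> R^o) * (V -> R^o)) :=
  [set q | [/\ dual q.1, dual q.2 & D (pair_functional q.1 q.2)]].

Definition normal_cone (W : normedModType R) (w0 : W) (A : set W) :
    set (W -> R^o) :=
  [set ws | dual ws /\ forall w, A w -> ws (w - w0) <= 0].

Definition subdifferential (W : normedModType R) (phi : W -> R) (w0 : W) :
    set (W -> R^o) :=
  [set ws | dual ws /\ forall w, ws (w - w0) <= phi w - phi w0].

Definition adjoint (U V : normedModType R) (T : U -> V) (vs : V -> R^o) :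
    U -> R^o := vs \o T.

End Duality.

Section SetValuedMaps.
Context {R : realType}.

Definition svdom (U V : Type) (G : U -> set V) : set U := [set u | G u !=set0].
Definition svgph (U V : Type) (G : U -> set V) : set (U * V) :=
  [set w | G w.1 w.2].
Definition svrge (U V : Type) (G : U -> set V) : set V := \bigcup_u G u.

Definition singleton_map (U V : Type) (g : U -> V) : U -> set V :=
  fun u => [set g u].

Context {U V : normedModType R}.
Implicit Types G : U -> set V.

Definition proper_map G := svdom G !=set0.
Definition convex_map G :=
  convex_set (svgph G : set (convex_lmodType (U * V)%type)).
Definition closed_map G := closed (svgph G).

Variable K : set V.

(* The profile map G + K. *)
Definition profile G : U -> set V := fun u => set_add (G u) K.
Definition epi G : set (U * V) := [set w | set_add (G w.1) K w.2].
Definition K_convex G := convex_set (epi G : set (convex_lmodType (U * V)%type)).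
Definition K_closed G := closed (epi G).

(* D^*G(u0, v0)(vs) for a point w0 = (u0, v0) of the graph. *)
Definition coderivative G (w0 : U * V) (vs : V -> R^o) : set (U -> R^o) :=
  [set us | dual us /\ normal_cone w0 (svgph G) (pair_functional us (- vs))].

End SetValuedMaps.

(* Frechet differentiable near z0, with the derivative continuous at z0 for the
   operator norm. *)
Definition continuously_differentiable_at {R : realType}
    {U V : normedModType R} (f : U -> V) (z0 : U) :=
  (\forall z \near z0, differentiable f z) /\
  (forall e : R, 0 < e -> \forall z \near z0,
     forall h, `|'d f z h - 'd f z0 h| <= e * `|h|).

Section ParametricProblem.
Context {R : realType} {P X Y : normedModType R}.
Variables (K : set Y) (f : P * X -> Y) (C : P -> set X).

Definition objective_map : P -> set Y :=
  fun p => [set y | exists2 x, C p x & y = f (p, x)].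

Definition perturbation_map : P -> set Y :=
  fun p => minimal_points K (objective_map p).

Definition solution_map : P -> set X :=
  fun p => [set x | C p x /\ perturbation_map p (f (p, x))].

Definition graph_map : P -> set (P * X) := fun p => [set p] `*` C p.

End ParametricProblem.

(* Main.v *)
Require Import Defs.
From HB Require Import structures.
From mathcomp Require Import all_boot all_order all_algebra.
From mathcomp Require Import all_classical all_reals all_analysis.
From mathcomp Require Import ring lra.

Set Implicit Arguments.
Unset Strict Implicit.
Unset Printing Implicit Defensive.

Import Order.TTheory GRing.Theory Num.Theory.
Import numFieldNormedType.Exports.

Local Open Scope classical_set_scope.
Local Open Scope ring_scope.

(** Write [w0 = (pbar, xbar)], and let [ys] be a continuous functional.

    Perturbing a point of a graph inside [K] shows that the coderivative of a
    profile map is empty at [ys] unless [ys] is nonnegative on [K], and that for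
    such [ys] the elements of [K] disappear from its definition
    ([coderivative_profileE]). So both sides of the first formula are empty
    outside the dual cone; on the dual cone the coderivative of [f + K] is the
    subdifferential of the scalarization [ys \o f], and the first two formulas
    become the same statement. There, [us] belongs to the coderivative of
    [F + K] iff [w0] minimizes [phi w = ys (f w) - us w.1] over the graph of
    [C]. Adding the defining inequalities gives the inclusion of the right-hand
    side in the left-hand side. The other inclusion asks for a multiplier rule:
    a minimizer of [phi] over a convex set [A] should admit a subgradient [l]
    of [phi] with [l (w - w0) >= 0] on [A]. Its two partial functionals then
    split [us] as required ([coderivative_objective]).

    The multiplier ([constrained_minimizer_multiplier]) comes from a sandwich
    theorem between a convex function and a convex cone on which it is
    nonnegative ([convex_cone_sandwich]), an application of the Hahn-Banach
    theorem for sublinear functionals ([hahn_banach]). The functional so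
    obtained is continuous as soon as [phi] is bounded above near [w0].

    This bound is where completeness and the closedness of the epigraph enter.
    The epigraph of [f] is a closed convex subset of [(P * X) * Y] whose
    projection is all of [P * X], so by the theorem of Robinson and Ursescu
    ([robinson_ursescu]) each point near [w0] is the
    projection of a point [(w, y)] of the epigraph with [y] in a fixed ball, and
    [ys (f w) <= ys y] is bounded ([scalarization_locally_bounded]).

    Finally, a convex function which is differentiable at [w0] has its
    differential as only subgradient ([subdifferential_differentiable]), so for
    differentiable [f] the union over the subgradients reduces to one term. *)

(** * Sublinear functionals and the Hahn-Banach theorem *)

Section Sublinear.
Context {R : realType} {V : lmodType R}.
Implicit Types (p q m : V -> R).

Definition sublinear p :=
  (forall x y, p (x + y) <= p x + p y) /\
  (forall t x, 0 < t -> p (t *: x) = t * p x).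

Lemma sublinear0 p : sublinear p -> p 0 = 0.
Proof. by move=> [_ /(_ 2 0)]; rewrite scaler0 ltr0n => /(_ isT); lra. Qed.

Lemma sublinearN_ge p x : sublinear p -> - p (- x) <= p x.
Proof.
move=> sp; have := sp.1 x (- x); rewrite subrr (sublinear0 sp); lra.
Qed.

(** The three infima below (over a chain, over a half-line, over a convex cone)
    are all sublinear for the same reason: the sets of candidate values are
    subadditive and positively homogeneous as families indexed by the vector. *)
Lemma sublinear_inf (N : V -> set R) :
  (forall x, N x !=set0) -> (forall x, has_lbound (N x)) ->
  (forall x y a b, N x a -> N y b -> exists2 c, N (x + y) c & c <= a + b) ->
  (forall t x a, 0 < t -> N x a -> N (t *: x) (t * a)) ->
  sublinear (fun x => inf (N x)).
Proof.
move=> N0 Nlb ND NZ; split=> [x y|t x t0] /=.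
  rewrite -lerBlDr; apply: lb_le_inf => // a Nxa.
  rewrite lerBlDr -lerBlDl; apply: lb_le_inf => // b Nyb.
  have [c Nc cab] := ND _ _ _ _ Nxa Nyb.
  by have := ge_inf (Nlb _) Nc; lra.
have le_scale s z : 0 < s -> inf (N (s *: z)) <= s * inf (N z).
  move=> s0; rewrite mulrC -ler_pdivrMr //; apply: lb_le_inf => // a Nza.
  by rewrite ler_pdivrMr // mulrC; apply: ge_inf => //; exact: NZ.
apply/eqP; rewrite eq_le le_scale//=.
have := le_scale t^-1 (t *: x); rewrite invr_gt0 => /(_ t0).
rewrite scalerA mulVf ?gt_eqF// scale1r.
by rewrite -(ler_pM2l t0) mulrA divff ?gt_eqF// mul1r.
Qed.

(** Zorn's lemma applies because the pointwise infimum of a chain of sublinear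
    functionals below [p] is finite: each of them is at least
    [- p (- x)] at [x]. *)
Lemma minimal_sublinear p : sublinear p ->
  exists m, [/\ sublinear m, forall x, m x <= p x &
    forall q, sublinear q -> (forall x, q x <= m x) -> q = m].
Proof.
move=> sp.
pose T := {q : V -> R | sublinear q /\ forall x, q x <= p x}.
pose below (q1 q2 : T) : bool := `[< forall x, sval q2 x <= sval q1 x >].
have below_trans r s t : below r s -> below s t -> below r t.
  by move=> /asboolP rs /asboolP st; apply/asboolP => x; exact: le_trans (rs x).
have T_ext (s t : T) : sval s = sval t -> s = t.
  by case: s t => [s Hs] [t Ht] /= st; subst t; congr exist;
    exact: Prop_irrelevance.
case: (@Zorn T below) => [t|//|s t /asboolP st /asboolP ts|A totA|m mmin].
- by apply/asboolP.
- by apply/T_ext/funext => x; apply/eqP; rewrite eq_le ts st.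
- have [->|/set0P[q0 Aq0]] := eqVneq A set0.
    by exists (exist _ p (conj sp (fun=> lexx _))).
  pose N x := [set sval q x | q in A].
  have N0 x : N x !=set0 by exists (sval q0 x), q0.
  have lbN x : lbound (N x) (- p (- x)).
    move=> _ [q Aq <-]; have [sq qp] := svalP q.
    by have := sublinearN_ge x sq; have := qp (- x); lra.
  have hlbN x : has_lbound (N x) by exists (- p (- x)); exact: lbN.
  have N_le (q : T) x : A q -> inf (N x) <= sval q x.
    by move=> Aq; apply: ge_inf => //; exists q.
  have sN : sublinear (fun x => inf (N x)).
    apply: sublinear_inf => // [x y _ _ [q Aq <-] [r Ar <-]|t x _ t0 [q Aq <-]].
      have [sq _] := svalP q; have [sr _] := svalP r.
      (* The smaller of two comparable functionals witnesses subadditivity. *)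
      have [/asboolP rq|/asboolP qr] := totA q r Aq Ar.
        exists (sval r (x + y)); first by exists r.
        by have := sr.1 x y; have := rq x; lra.
      exists (sval q (x + y)); first by exists q.
      by have := sq.1 x y; have := qr y; lra.
    by exists q => //; have [sq _] := svalP q; rewrite sq.2.
  have Np x : inf (N x) <= p x.
    by apply: le_trans (N_le _ _ Aq0) _; have [_] := svalP q0.
  exists (exist _ (fun x => inf (N x)) (conj sN Np)) => q Aq.
  by apply/asboolP => x; exact: N_le.
- exists (sval m); have [sm mp] := svalP m; split=> // q sq qm.
  have qp x : q x <= p x by exact: le_trans (qm x) (mp x).
  have -> // : m = exist _ q (conj sq qp) by apply/esym/mmin/asboolP.
Qed.

(** A minimal sublinear functional [m] is linear. For fixed [y], the functional
    [x |-> inf (m (x + t y) - t m y)] over [t >= 0] is sublinear and below [m],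
    hence equal to [m]; at [x = - y] and [t = 1] this gives [m (- y) <= - m y],
    and an odd sublinear functional is additive. *)
Lemma hahn_banach p : sublinear p ->
  exists l : V -> R^o, linear l /\ forall x, l x <= p x.
Proof.
move=> /minimal_sublinear[m [sm mp mmin]]; exists m; split=> // {p mp}.
have mN y : m (- y) = - m y.
  apply/eqP; rewrite eq_le; apply/andP; split; last first.
    by have := sublinearN_ge (- y) sm; rewrite opprK.
  pose N x := [set r | exists2 t, 0 <= t & r = m (x + t *: y) - t * m y].
  have Nm x : N x (m x) by exists 0 => //; rewrite scale0r addr0 mul0r subr0.
  have hlbN x : has_lbound (N x).
    exists (- m (- x)) => _ [t t0 ->].
    have := sm.1 (x + t *: y) (- x); rewrite addrAC subrr add0r.
    have -> : m (t *: y) = t * m y.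
      move: t0; rewrite le_eqVlt => /predU1P[<-|/sm.2 //].
      by rewrite scale0r mul0r sublinear0.
    by lra.
  have sN : sublinear (fun x => inf (N x)).
    apply: sublinear_inf => //
      [x|x z _ _ [t t0 ->] [s s0 ->]|t x _ t0 [s s0 ->]].
    - by exists (m x).
    - exists (m (x + z + (t + s) *: y) - (t + s) * m y).
        by exists (t + s) => //; rewrite addr_ge0.
      have := sm.1 (x + t *: y) (z + s *: y).
      by rewrite addrACA -scalerDl; lra.
    - exists (t * s); first by rewrite mulr_ge0 // ltW.
      by rewrite mulrBr -(sm.2 t (_ + _))// scalerDr scalerA mulrA.
  rewrite -(mmin _ sN); last by move=> x; exact: ge_inf.
  apply: ge_inf => //; exists 1 => //.
  by rewrite scale1r addNr sublinear0// mul1r sub0r -(mmin _ sN)// => x;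
    exact: ge_inf.
have mD x y : m (x + y) = m x + m y.
  apply/eqP; rewrite eq_le sm.1 /=.
  by have := sm.1 (x + y) (- y); rewrite addrK mN; lra.
have mZ t x : m (t *: x) = t * m x.
  have [t0|t0|->] := ltrgtP t 0; last by rewrite scale0r mul0r sublinear0.
    by rewrite -[t]opprK scaleNr mN mulNr sm.2// oppr_gt0.
  exact: sm.2.
by move=> a x y; rewrite mD mZ.
Qed.

End Sublinear.

(** * Completeness of products *)

Section ProductComplete.
Context {R : realType} {U V : completeNormedModType R}.

Lemma prod_cauchy_cvg (F : set_system (U * V)) : ProperFilter F -> cauchy F ->
  exists a : U * V, F --> a.
Proof.
move=> PF /cauchyP cF.
have /cvg_ex[a Fa] : cvg (fst @ F).
  apply: cauchy_cvg; apply/cauchyP => e e0.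
  have [[x y] xyF] := cF e e0; exists x.
  have sub : ball (x, y) e `<=` fst @^-1` ball x e by move=> q [].
  exact: filterS sub xyF.
have /cvg_ex[b Fb] : cvg (snd @ F).
  apply: cauchy_cvg; apply/cauchyP => e e0.
  have [[x y] xyF] := cF e e0; exists y.
  have sub : ball (x, y) e `<=` snd @^-1` ball y e by move=> q [].
  exact: filterS sub xyF.
exists (a, b) => A Aab.
have sub : (fun w => (w.1, w.2)) @^-1` A `<=` A by case.
exact: filterS sub (cvg_pair Fa Fb Aab).
Qed.

(* Completeness is stated for pointed uniform spaces: the two structures have to
   be joined first. *)
HB.instance Definition _ := Pointed.on (U * V)%type.

Let prod_complete (F : set_system (U * V)) :
  ProperFilter F -> cauchy F -> cvg F.
Proof. by move=> PF cF; apply/cvg_ex/prod_cauchy_cvg. Qed.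

HB.instance Definition _ := Uniform_isComplete.Build (U * V)%type prod_complete.

End ProductComplete.

(** * Closed convex sets with full projection *)

Lemma convex_setE (R : realType) (V : lmodType R) (A : set V) :
  convex_set (A : set (convex_lmodType V)) <->
  forall (t : R) x y, 0 <= t -> t <= 1 -> A x -> A y ->
    A (t *: x + (1 - t) *: y).
Proof.
split=> [cA t x y t0 t1 Ax Ay|cA x y t /set_mem Ax /set_mem Ay].
  have := cA x y (Itv01 t0 t1).
  by rewrite !inE => /(_ Ax Ay).
by apply/mem_set/cA.
Qed.

(** The weights [1/2, ..., 1/2^n, 1/2^n] sum to one; absorbing the last two terms
    into a single point [(a n + c) / 2] reduces [n + 1] to [n]. *)
Lemma dyadic_convex (R : realType) (V : lmodType R) (A : set V) :
  convex_set (A : set (convex_lmodType V)) ->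
  forall (a : nat -> V) n c, (forall i, A (a i)) -> A c ->
  A (\sum_(0 <= i < n) 2^-1 ^+ i.+1 *: a i + 2^-1 ^+ n *: c).
Proof.
move=> /convex_setE cA a; elim=> [|n IHn] c Aa Ac.
  by rewrite big_geq// add0r expr0 scale1r.
rewrite big_nat_recr//= -addrA -scalerDr.
rewrite exprSr -scalerA scalerDr; apply: IHn => //.
have -> : 2^-1 *: c = (1 - 2^-1) *: c by congr (_ *: _); lra.
by apply: cA => //; lra.
Qed.

Lemma cvg_dyadic0 (R : realType) (V : normedModType R) (v : V ^nat) M :
  (forall n, `|v n| <= M) -> 2^-1 ^+ n *: v n @[n --> \oo] --> (0 : V).
Proof.
move=> vM; apply/norm_cvg0P.
apply: (@squeeze_cvgr _ _ _ _ (fun=> 0) (geometric M 2^-1)).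
- apply: nearW => n; rewrite normr_ge0 /= normrZ ger0_norm ?exprn_ge0//.
  by rewrite mulrC ler_wpM2r ?exprn_ge0.
- exact: cvg_cst.
- by apply: cvg_geometric; rewrite ger0_norm//; lra.
Qed.

Lemma is_cvg_dyadic_series (R : realType) (V : completeNormedModType R)
  (v : V ^nat) M : (forall n, `|v n| <= M) ->
  cvgn (series (fun i => 2^-1 ^+ i.+1 *: v i)).
Proof.
move=> vM; apply: normed_cvg.
apply: (@series_le_cvg _ _ (geometric (M * 2^-1) 2^-1)) => [n|n|n|].
- by rewrite /= normr_ge0.
- by rewrite /geometric /= !mulr_ge0 ?exprn_ge0// (le_trans _ (vM 0)).
- rewrite /geometric /= normrZ ger0_norm ?exprn_ge0// exprS mulrC -mulrA.
  by rewrite ler_wpM2r// mulr_ge0 ?exprn_ge0.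
- by apply: is_cvg_geometric_series; rewrite ger0_norm//; lra.
Qed.

Lemma closure_norm_approx (R : realType) (V : normedModType R) (A : set V) x :
  closure A x -> forall e, 0 < e -> exists2 a, A a & `|x - a| < e.
Proof.
move=> Ax e e0; have [a [Aa]] := Ax _ (nbhsx_ballx x e e0).
by rewrite -ball_normE => xa; exists a.
Qed.

(** The dyadic iteration of the open mapping theorem, with convex combinations
    in place of sums. A vector [z] of norm less than [r] is approximated, within
    [r / 2], by [t - w0] for a point [t] of the projection; the error, doubled,
    is again of norm less than [r], so the step can be repeated. This writes
    [z / 2] as the dyadic convex series of the [t_i - w0], and the series of the
    points of [D] above the [t_i] converges because their second components are
    bounded and [Y] is complete. *)
Lemma dense_projection_ball (R : realType) (W : normedModType R)
    (Y : completeNormedModType R) (D : set (W * Y)) (M r : R) (w0 : W) :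
  convex_set (D : set (convex_lmodType (W * Y)%type)) -> closed D ->
  (forall q, D q -> `|q.2| <= M) -> 0 < r -> (fst @` D) w0 ->
  ball w0 r `<=` closure (fst @` D) -> ball w0 (r / 2) `<=` fst @` D.
Proof.
move=> cD clD DM r0 [[w0' y0] D0 /= w0E] dense_proj w; subst w0'.
rewrite -ball_normE /= => w0w.
have pick_ex z : exists q, `|z| < r -> D q /\ `|w0 + z - q.1| < r / 2.
  have [zr|] := boolP (`|z| < r); last by move=> _; exists (w0, y0).
  have /closure_norm_approx Dz : closure (fst @` D) (w0 + z).
    by apply: dense_proj; rewrite -ball_normE /= opprD addNKr normrN.
  have r20 : 0 < r / 2 by rewrite divr_gt0.
  by have [_ [q Dq <-] qz] := Dz _ r20; exists q.
have [pick pickP] := choice pick_ex.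
(* The factor 2 in z 0 undoes the halving of the ball: z 0 / 2 = w - w0. *)
pose z := fix z n := if n is m.+1 then 2 *: (w0 + z m - (pick (z m)).1)
                     else 2 *: (w - w0).
have zr n : `|z n| < r.
  elim: n => [|n /pickP[_]] /=; rewrite normrZ ger0_norm//.
    by rewrite distrC; lra.
  by lra.
pose q n := pick (z n).
have Dq n : D (q n) by have [] := pickP _ (zr n).
pose s n := \sum_(0 <= i < n) 2^-1 ^+ i.+1 *: q i + 2^-1 ^+ n *: (w0, y0).
have Ds n : D (s n) by exact: dyadic_convex.
(* The truncated combinations are completed by the base point (w0, y0), so that
   each is a point of D whose projection differs from w by z n / 2^(n+1). *)
have s1 n : (s n).1 = w - 2^-1 *: (2^-1 ^+ n *: z n).
  rewrite /s /= (big_morph fst (id1 := 0) (op1 := +%R))//=.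
  elim: n => [|n IHn].
    rewrite big_geq// add0r !scale1r scalerA mulVf// scale1r.
    by rewrite opprB addrC subrK.
  rewrite big_nat_recr//= (canRL (addrK _) IHn) !scalerA -/(q n).
  have -> : 2^-1 * 2^-1 ^+ n = 2^-1 ^+ n.+1 :> R by rewrite exprS.
  have -> : 2^-1 * 2^-1 ^+ n.+1 * 2 = 2^-1 ^+ n.+1 :> R by field.
  have -> : 2^-1 ^+ n = 2^-1 ^+ n.+1 + 2^-1 ^+ n.+1 :> R by rewrite exprS; lra.
  move: (2^-1 ^+ n.+1) => h; rewrite scalerDl opprD.
  rewrite scalerBr scalerDr.
  rewrite addrA [LHS]addrAC subrK !opprD opprK !addrA.
  by congr (_ + _); rewrite addrAC.
have s2 n : (s n).2 =
    series (fun i => 2^-1 ^+ i.+1 *: (q i).2) n + 2^-1 ^+ n *: y0.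
  by rewrite /s /= (big_morph snd (id1 := 0) (op1 := +%R)).
have qM n : `|(q n).2| <= M by exact: DM.
have /cvg_ex[l ql] := is_cvg_dyadic_series qM.
have s1w : (s n).1 @[n --> \oo] --> w.
  suff : (s n).1 @[n --> \oo] --> w - 2^-1 *: 0 by rewrite scaler0 subr0.
  rewrite (eq_cvg _ _ s1).
  apply: cvgB; first exact: cvg_cst.
  apply: cvgZr; apply: cvg_dyadic0 => n; exact/ltW/zr.
have s2l : (s n).2 @[n --> \oo] --> l.
  suff : (s n).2 @[n --> \oo] --> l + 0 by rewrite addr0.
  rewrite (eq_cvg _ _ s2).
  by apply: cvgD => //; apply: cvg_dyadic0 => n; exact: lexx.
exists (w, l) => //.
apply: (@closed_cvg _ _ \oo _ (fun n => ((s n).1, (s n).2)) _ clD).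
  by apply: nearW => n; rewrite -surjective_pairing.
exact: cvg_pair.
Qed.

Lemma baire_cover (R : realType) (W : completeNormedModType R)
    (T : (set W)^nat) :
  (forall w, exists n, T n w) ->
  exists n u r, 0 < r /\ ball u r `<=` closure (T n).
Proof.
move=> Tcov; apply: contrapT => nball.
have /Baire : forall i, open (~` closure (T i)) /\ dense (~` closure (T i)).
  move=> i; split; first exact/closed_openC/closed_closure.
  move=> O [u Ou] oO; apply: contrapT => /set0P/negP/negPn/eqP OT.
  have /nbhs_ballP[r /= r0 uO] := open_nbhs_nbhs (conj oO Ou).
  apply: nball; exists i, u, r; split=> // w /uO Ow; apply: contrapT => Tw.
  by have : set0 w by rewrite -OT.
move=> /(_ setT (ex_intro _ 0 I) openT)[w [_ wT]].
have [n Tnw] := Tcov w.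
by apply: (wT n I); exact: subset_closure.
Qed.

(** The parts of [D] with second component in the ball of radius [n] project onto
    sets that cover [W]; by Baire's theorem one of the projections is dense in
    some ball, centred at a point [u]. Averaging with a point of [D] above the
    reflection [2 w0 - u] moves the centre to [w0], and
    [dense_projection_ball] removes the closure. *)
Lemma robinson_ursescu (R : realType) (W Y : completeNormedModType R)
    (D : set (W * Y)) (w0 : W) :
  convex_set (D : set (convex_lmodType (W * Y)%type)) -> closed D ->
  fst @` D = setT ->
  exists M r, 0 < r /\
    ball w0 r `<=` fst @` (D `&` [set q | `|q.2| <= M]).
Proof.
move=> cD clD DT.
pose B (M : R) := D `&` [set q : W * Y | `|q.2| <= M].
have cB M : convex_set (B M : set (convex_lmodType (W * Y)%type)).
  apply/convex_setE => t x y t0 t1 [Dx xM] [Dy yM]; split.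
    by move/convex_setE : cD; exact.
  apply: le_trans (ler_normD _ _) _.
  rewrite !normrZ (ger0_norm t0) ger0_norm ?subr_ge0//.
  have -> : M = t * M + (1 - t) * M by ring.
  by rewrite lerD// ler_wpM2l// subr_ge0.
have clB M : closed (B M).
  apply: closedI => //.
  rewrite -[X in closed X]/(snd @^-1` [set y : Y | `|y| <= M]).
  apply: closed_comp => [q _|]; first exact: cvg_snd.
  apply: (@closed_comp _ _ (fun y : Y => `|y|) [set t | t <= M]).
    by move=> y _; exact: norm_continuous.
  exact: closed_le.
have [n [u [r [r0 uB]]]] :
    exists (n : nat) u r, 0 < r /\ ball u r `<=` closure (fst @` B n%:R).
  apply: baire_cover => w; have : (fst @` D) w by rewrite DT.
  move=> [q Dq <-]; exists (Num.bound `|q.2|), q => //; split=> //=.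
  exact/ltW/archi_boundP.
have : (fst @` D) (2 *: w0 - u) by rewrite DT.
move=> [q Dq q1]; have : (fst @` D) w0 by rewrite DT.
move=> [q0 Dq0 q01].
(* The bound must hold above u, above its reflection and above w0 at once. *)
pose M := n%:R + `|q.2| + `|q0.2|.
(* The averaging halves the radius, and so does the removal of the closure. *)
exists M, (r / 2 / 2); split; first by rewrite !divr_gt0.
apply: (dense_projection_ball (cB M) (clB M) (M := M)).
- by move=> ? [].
- by rewrite divr_gt0.
- exists q0 => //; split=> //=; rewrite /M.
  by have := ler0n R n; have := normr_ge0 q.2; lra.
move=> w; rewrite -ball_normE /= => w0w A /nbhs_ballP[e /= e0 wA].
have : closure (fst @` B n%:R) (u + 2 *: (w - w0)).
  apply: uB; rewrite -ball_normE /= opprD addNKr normrN normrZ ger0_norm//.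
  by rewrite distrC; lra.
move=> /closure_norm_approx/(_ _ e0)[_ [p [Dp pn] <-] pe].
pose m : W := 2^-1 *: p.1 + (1 - 2^-1) *: q.1.
exists m; split.
  exists (2^-1 *: p + (1 - 2^-1) *: q) => //.
  move/convex_setE : (cB M); apply; rewrite ?invr_ge0 ?invf_le1 ?ler1n //.
    by split=> //=; apply: le_trans pn _; rewrite /M -addrA lerDl addr_ge0.
  by split=> //=; rewrite /M; have := ler0n R n; have := normr_ge0 q0.2; lra.
apply: wA; rewrite -ball_normE /=.
have -> : w - (2^-1 *: p.1 + (1 - 2^-1) *: q.1) =
    2^-1 *: (u + 2 *: (w - w0) - p.1).
  have -> : 1 - 2^-1 = 2^-1 :> R by lra.
  rewrite -scalerDr -{1}[w](scalerK (a := 2)) ?pnatr_eq0// -scalerBr q1.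
  congr (_ *: _); rewrite scalerBr opprD opprB addrCA [RHS]addrC.
  by congr (_ + _); rewrite addrCA.
rewrite normrZ ger0_norm//.
by move: pe (normr_ge0 (u + 2 *: (w - w0) - p.1)); lra.
Qed.

(** * A multiplier rule for convex minimization *)

Lemma convex_functionE (R : realType) (V : lmodType R) (phi : V -> R) :
  convex_function (setT : set (convex_lmodType V)) phi <->
  forall (t : R) x y, 0 <= t -> t <= 1 ->
    phi (t *: x + (1 - t) *: y) <= t * phi x + (1 - t) * phi y.
Proof.
split=> [cphi t x y t0 t1|cphi t x y _ _]; last exact: cphi.
by apply: (cphi (Itv01 t0 t1)); rewrite inE.
Qed.

(** The elements of a dual space are bare functions; bundling one gives access to
    the theory of linear maps. *)
Lemma linear_fun_ex (R : realType) (V : lmodType R) (l : V -> R^o) :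
  linear l -> exists L : {linear V -> R^o}, (L : V -> R^o) = l.
Proof.
move=> lin; pose linM := GRing.isLinear.Build R V R^o _ l lin.
by exists (HB.pack_for {linear V -> R^o} l linM).
Qed.

Section Sandwich.
Context {R : realType} {V : lmodType R}.

(** The infimum over [t > 0] and [d] in [C] of [psi (t (h + d)) / t] is sublinear
    in [h]. It is at most [psi h] (take [d = 0]) and nonpositive at [- d] for [d]
    in [C], so a linear functional below it is below [psi] and nonnegative on
    [C]. *)
Lemma convex_cone_sandwich (psi : V -> R) (C : set V) :
  convex_function (setT : set (convex_lmodType V)) psi -> psi 0 = 0 ->
  C 0 -> (forall c d, C c -> C d -> C (c + d)) ->
  (forall t d, 0 < t -> C d -> C (t *: d)) ->
  (forall d, C d -> 0 <= psi d) ->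
  exists l : V -> R^o, [/\ linear l, forall x, l x <= psi x &
    forall d, C d -> 0 <= l d].
Proof.
move=> /convex_functionE cpsi psi0 C0 CD CZ psiC.
pose N h := [set r | exists t d,
  [/\ 0 < t, C d & r = t^-1 * psi (t *: (h + d))]].
have Npsi h : N h (psi h).
  by exists 1, 0; split => //; rewrite invr1 mul1r scale1r addr0.
have hlbN h : has_lbound (N h).
  exists (- psi (- h)) => _ [t [d [t0 Cd ->]]].
  (* The combination of t (h + d) and - h with weights la and la t lies in C, as
     the h terms cancel; there psi is nonnegative. *)
  pose la := (1 + t)^-1.
  have laE : 1 - la = la * t by rewrite /la; field; lra.
  have la0 : 0 < la by rewrite invr_gt0; lra.
  have la1 : la <= 1 by rewrite invf_le1; lra.
  have := cpsi la (t *: (h + d)) (- h) (ltW la0) la1.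
  rewrite laE scalerA -scalerDr [h + d]addrC addrK.
  have /psiC : C ((la * t) *: d) by apply: CZ => //; rewrite mulr_gt0.
  move=> ge0 /(le_trans ge0); rewrite -mulrA -mulrDr pmulr_rge0// => le1.
  by rewrite -(ler_pM2l t0) mulrA divff ?gt_eqF// mul1r; lra.
have sN : sublinear (fun h => inf (N h)).
  apply: sublinear_inf => // [h|h k _ _ [t [c [t0 Cc ->]]] [s [d [s0 Cd ->]]]|].
  - by exists (psi h).
  - have ts0 : 0 < t + s by rewrite addr_gt0.
    have tsn0 : t + s != 0 by rewrite gt_eqF.
    have tn0 : t != 0 by rewrite gt_eqF.
    have sn0 : s != 0 by rewrite gt_eqF.
    (* These weights satisfy la t = (1 - la) s = u, so that the two arguments
       combine into u (h + k + (c + d)). *)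
    pose la := s / (t + s); pose u := t * s / (t + s).
    have u0 : 0 < u by rewrite divr_gt0// mulr_gt0.
    exists (u^-1 * psi (u *: (h + k + (c + d)))).
      by exists u, (c + d); split=> //; exact: CD.
    have la0 : 0 <= la by rewrite divr_ge0// ltW.
    have la1 : la <= 1 by rewrite ler_pdivrMr// mul1r lerDr ltW.
    have := cpsi la (t *: (h + c)) (s *: (k + d)) la0 la1.
    rewrite !scalerA.
    have -> : la * t = u by rewrite /la /u; field.
    have -> : (1 - la) * s = u by rewrite /la /u; field.
    rewrite -scalerDr addrACA => cpsi_la.
    rewrite -(ler_pM2l u0) mulrA divff ?gt_eqF// mul1r.
    apply: le_trans cpsi_la _; rewrite mulrDr !mulrA.
    have -> : u / t = la by rewrite /la /u; field; rewrite tsn0 tn0.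
    have -> : u / s = 1 - la by rewrite /la /u; field; rewrite tsn0 sn0.
    exact: lexx.
  - move=> s h _ s0 [t [d [t0 Cd ->]]]; exists (t / s), (s *: d).
    split; [by rewrite divr_gt0|exact: CZ|].
    rewrite -scalerDr scalerA divfK ?gt_eqF// mulrA; congr (_ * _).
    by rewrite invf_div.
have [l [linl lN]] := hahn_banach sN; exists l; split => // [x|d Cd].
  by apply: le_trans (lN x) _; exact: ge_inf.
have [L LE] := linear_fun_ex linl.
rewrite -oppr_le0 -LE -linearN LE.
apply: le_trans (lN _) _; apply: ge_inf => //; exists 1, d; split=> //.
by rewrite addNr scaler0 psi0 mulr0.
Qed.

End Sandwich.

Lemma linear_bounded_above_continuous (R : realType) (W : normedModType R)
    (l : W -> R^o) (M r : R) :
  linear l -> 0 < r -> (forall h, `|h| < r -> l h <= M) -> continuous l.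
Proof.
move=> /linear_fun_ex[L <-] r0 lM; apply: bounded_linear_continuous.
apply/ex_bound; exists M; apply/nbhs_norm0P; exists r => //= h hr.
rewrite /= ler_norml lM// andbT lerNl -linearN; apply: lM.
by rewrite normrN.
Qed.

(** After translation to [w0] this is the sandwich theorem for the cone generated
    by [A - w0]: the minimality of [phi w0] on [A] extends to that cone by
    convexity along the segments issued from [w0]. The upper bound on [phi] near
    [w0] bounds the functional, hence makes it continuous. *)
Lemma constrained_minimizer_multiplier (R : realType) (W : normedModType R)
    (phi : W -> R) (A : set W) (w0 : W) (M r : R) :
  convex_function (setT : set (convex_lmodType W)) phi ->
  convex_set (A : set (convex_lmodType W)) -> A w0 ->
  0 < r -> (forall w, ball w0 r w -> phi w <= M) ->
  (forall w, A w -> phi w0 <= phi w) ->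
  exists l : W -> R^o, subdifferential phi w0 l /\
    forall w, A w -> 0 <= l (w - w0).
Proof.
move=> cphi cA Aw0 r0 phiM phimin.
have := cphi => /convex_functionE cphi'.
have := cA => /convex_setE cA'.
pose psi x := phi (w0 + x) - phi w0.
have translate t x y : w0 + (t *: x + (1 - t) *: y) =
    t *: (w0 + x) + (1 - t) *: (w0 + y).
  by rewrite !scalerDr addrACA -scalerDl (addrC t) subrK scale1r.
have cpsi : convex_function (setT : set (convex_lmodType W)) psi.
  apply/convex_functionE => t x y t0 t1; rewrite /psi translate.
  by have := cphi' t (w0 + x) (w0 + y) t0 t1; lra.
pose C := cone (set_sub A [set w0]).
have CE d : C d <-> exists s a, [/\ 0 <= s, A a & d = s *: (a - w0)].
  split=> [[s [_ [s0 [a Aa [_ -> <-]] ->]]]|[s [a [s0 Aa ->]]]].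
    by exists s, a.
  by exists s, (a - w0); split=> //; exists a => //; exists w0.
have [] := @convex_cone_sandwich R W psi C cpsi.
- by rewrite /psi addr0 subrr.
- by apply/CE; exists 0, w0; rewrite scale0r.
- move=> _ _ /CE[s [a [s0 Aa ->]]] /CE[t [b [t0 Ab ->]]]; apply/CE.
  have [st0|stn0] := eqVneq (s + t) 0.
    have [-> ->] : s = 0 /\ t = 0 by split; lra.
    by exists 0, w0; rewrite !scale0r addr0.
  have stp : 0 < s + t by rewrite lt_neqAle eq_sym stn0 addr_ge0.
  exists (s + t), ((s / (s + t)) *: a + (1 - s / (s + t)) *: b); split.
  + by rewrite addr_ge0.
    apply: cA' => //; rewrite ?divr_ge0 ?ler_pdivrMr ?mul1r ?lerDl //.
    exact: ltW.
  + rewrite [RHS]scalerBr [in RHS]scalerDr !scalerA.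
    have -> : (s + t) * (s / (s + t)) = s by field.
    have -> : (s + t) * (1 - s / (s + t)) = t by field.
    by rewrite scalerDl !scalerBr opprD addrACA.
- move=> t _ t0 /CE[s [a [s0 Aa ->]]]; apply/CE; exists (t * s), a.
  by rewrite scalerA mulr_ge0// ltW.
- move=> _ /CE[s [a [s0 Aa ->]]]; rewrite /psi subr_ge0.
  have [s1|s1] := leP s 1.
    have := cA' s a w0 s0 s1 Aa Aw0 => /phimin.
    have -> // : s *: a + (1 - s) *: w0 = w0 + s *: (a - w0).
    by rewrite scalerBl scale1r scalerBr addrCA.
  have sp : 0 < s by lra.
  have sV0 : 0 < s^-1 by rewrite invr_gt0.
  have sV1 : s^-1 <= 1 by rewrite invf_le1 // ltW.
  have := cphi' s^-1 (w0 + s *: (a - w0)) w0 (ltW sV0) sV1.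
  have -> : s^-1 *: (w0 + s *: (a - w0)) + (1 - s^-1) *: w0 = a.
    rewrite -[w0 in X in _ + X]addr0 -translate scaler0 addr0.
    by rewrite scalerA mulVf ?gt_eqF// scale1r addrC subrK.
  move=> /(le_trans (phimin _ Aa)) le1.
  by rewrite -(ler_pM2l sV0); lra.
move=> l [linl lpsi lC]; exists l; split.
  split=> [|w]; last by have := lpsi (w - w0); rewrite /psi [w0 + _]addrC subrK.
  split=> //.
  apply: (@linear_bounded_above_continuous _ _ _ (M - phi w0) r) => // h hr.
  apply: le_trans (lpsi h) _; rewrite /psi lerB// phiM// -ball_normE /=.
  by rewrite opprD addNKr normrN.
by move=> w Aw; apply: lC; apply/CE; exists 1, w; rewrite scale1r ler01.
Qed.

(** * Continuous functionals on products *)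

Section Dual.
Context {R : realType}.
Implicit Types (U V W : normedModType R).

Lemma dual_linear_ex V (l : V -> R^o) : dual l ->
  exists2 L : {linear V -> R^o}, (L : V -> R^o) = l & continuous L.
Proof. by move=> [/linear_fun_ex[L LE] lc]; exists L => //; rewrite LE. Qed.

Lemma dual0 V (l : V -> R^o) : dual l -> l 0 = 0.
Proof. by move=> /dual_linear_ex[L <- _]; rewrite linear0. Qed.

Lemma dualD V (l : V -> R^o) x y : dual l -> l (x + y) = l x + l y.
Proof. by move=> /dual_linear_ex[L <- _]; rewrite linearD. Qed.

Lemma dualN V (l : V -> R^o) x : dual l -> l (- x) = - l x.
Proof. by move=> /dual_linear_ex[L <- _]; rewrite linearN. Qed.

Lemma dualB V (l : V -> R^o) x y : dual l -> l (x - y) = l x - l y.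
Proof. by move=> dl; rewrite dualD// dualN. Qed.

Lemma dualZ V (l : V -> R^o) t x : dual l -> l (t *: x) = t * l x.
Proof. by move=> /dual_linear_ex[L <- _]; rewrite linearZ. Qed.

Lemma dual_bounded V (l : V -> R^o) (r : R) : dual l ->
  exists M : R, forall x, `|x| <= r -> `|l x| <= M.
Proof.
move=> /dual_linear_ex[L <- cL].
by have /linear_bounded_continuous/bounded_funP/(_ r) := cL.
Qed.

Lemma dual_opp V (l : V -> R^o) : dual l -> dual (- l).
Proof.
move=> [ll cl]; split=> [a x y|x]; last exact: cvgN (cl x).
by rewrite /= !fctE ll opprD scalerN.
Qed.

Lemma dual_add V (k l : V -> R^o) : dual k -> dual l -> dual (k + l).
Proof.
move=> [lk ck] [ll cl]; split=> [a x y|x]; last exact: cvgD (ck x) (cl x).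
by rewrite /= !fctE lk ll scalerDr addrACA.
Qed.

Lemma dual_comp V W (T : {linear V -> W}) (l : W -> R^o) :
  continuous T -> dual l -> dual (l \o T).
Proof.
move=> cT [ll cl]; split=> [a x y|x]; first by rewrite /= linearP ll.
exact: cvg_comp (cT x) (cl _).
Qed.

Lemma dual_pair U V (us : U -> R^o) (vs : V -> R^o) : dual us -> dual vs ->
  dual (pair_functional us vs).
Proof.
move=> [lu cu] [lv cv]; split=> [a x y|x].
  by rewrite /pair_functional /= lu lv scalerDr addrACA.
apply: continuousD; apply: continuous_comp;
  [exact: cvg_fst|exact: cu|exact: cvg_snd|exact: cv].
Qed.

Lemma dual_inl U V (l : U * V -> R^o) : dual l -> dual (fun u => l (u, 0)).
Proof.
move=> [ll cl]; split=> [a x y|x].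
  rewrite -ll; congr l.
  by apply: injective_projections; rewrite /= ?scaler0 ?addr0.
apply: (@continuous_comp _ _ _ (fun u : U => (u, 0 : V)) l); last exact: cl.
by apply: cvg_pair => //; exact: cvg_cst.
Qed.

Lemma dual_inr U V (l : U * V -> R^o) : dual l -> dual (fun v => l (0, v)).
Proof.
move=> [ll cl]; split=> [a x y|x].
  rewrite -ll; congr l.
  by apply: injective_projections; rewrite /= ?scaler0 ?addr0.
apply: (@continuous_comp _ _ _ (fun v : V => (0 : U, v)) l); last exact: cl.
by apply: cvg_pair => //; exact: cvg_cst.
Qed.

Lemma pair_functionalK U V (l : U * V -> R^o) : dual l ->
  pair_functional (fun u => l (u, 0)) (fun v => l (0, v)) = l.
Proof.
move=> dl; apply/funext => -[u v]; rewrite /pair_functional/= -dualD//.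
by congr l; apply: injective_projections; rewrite /= ?addr0 ?add0r.
Qed.

End Dual.

(** * Coderivatives of profile maps and scalarization *)

(** Only the points [(u0, v0 + k)] are needed for the sign of [vs] on [K]; once
    this sign is known, adding an element of [K] to [v] weakens the inequality
    that defines the normal cone, so it suffices to test it on the graph of
    [G]. *)
Lemma coderivative_profileE (R : realType) (U V : normedModType R) (K : set V)
    (G : U -> set V) u0 v0 (vs : V -> R^o) (us : U -> R^o) :
  dual vs -> K 0 -> G u0 v0 ->
  coderivative (profile K G) (u0, v0) vs us <->
  [/\ dual us, forall k, K k -> 0 <= vs k &
      forall u v, G u v -> us (u - u0) <= vs (v - v0)].
Proof.
move=> dvs K0 Guv.
have pairE u v : pair_functional us (- vs) ((u, v) - (u0, v0)) =
  us (u - u0) - vs (v - v0) by [].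
split=> [[dus [_ nc]]|[dus Kpos le]].
  have le u v k : G u v -> K k -> us (u - u0) <= vs (v + k - v0).
    move=> Gv Kk; rewrite -subr_le0 -pairE; apply: nc.
    by exists v => //; exists k.
  split=> // [k Kk|u v Gv]; last by have := le u v 0 Gv K0; rewrite addr0.
  by have := le u0 v0 k Guv Kk; rewrite subrr dual0// addrC addKr.
split=> //; split; first exact: dual_pair (dual_opp dvs).
move=> [u y] [v /= Gv [k Kk <-]]; rewrite pairE subr_le0.
apply: le_trans (le u v Gv) _.
by rewrite addrAC [leRHS]dualD// lerDl Kpos.
Qed.

Lemma epi_singletonP (R : realType) (W Y : normedModType R) (K : set Y)
    (f : W -> Y) w y :
  epi K (singleton_map f) (w, y) <-> exists2 k, K k & y = f w + k.
Proof.
split=> [[v /= -> [k Kk <-]]|[k Kk ->]]; first by exists k.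
by exists (f w) => //; exists k.
Qed.

Lemma scalarization_convex (R : realType) (W Y : normedModType R) (K : set Y)
    (f : W -> Y) (ys : Y -> R^o) :
  dual_cone K ys -> K 0 -> K_convex K (singleton_map f) ->
  convex_function (setT : set (convex_lmodType W)) (ys \o f).
Proof.
move=> [dys yspos] K0 /convex_setE cf; apply/convex_functionE => t x y t0 t1 /=.
have epif w : epi K (singleton_map f) (w, f w).
  by apply/epi_singletonP; exists 0 => //; rewrite addr0.
have /epi_singletonP[k Kk E] := cf t _ _ t0 t1 (epif x) (epif y).
by rewrite -!dualZ// -dualD// E dualD// lerDl yspos.
Qed.

(** The epigraph of [f] projects onto [W], so near [w0] there are points [(w, y)]
    of the epigraph with [y] bounded, and [ys (f w) <= ys y] since [ys] is
    nonnegative on [K]. *)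
Lemma scalarization_locally_bounded (R : realType)
    (W Y : completeNormedModType R) (K : set Y) (f : W -> Y) (ys : Y -> R^o) :
  dual_cone K ys -> K 0 -> K_convex K (singleton_map f) ->
  K_closed K (singleton_map f) -> forall w0, exists M r, 0 < r /\
    forall w, ball w0 r w -> (ys \o f) w <= M.
Proof.
move=> [dys yspos] K0 cf clf w0.
have [|M [r [r0 wr]]] := robinson_ursescu w0 cf clf.
  apply/seteqP; split=> // w _; exists (w, f w) => //.
  by apply/epi_singletonP; exists 0 => //; rewrite addr0.
have [N yN] := dual_bounded M dys.
exists N, r; split=> // w /wr[[w' y] [/epi_singletonP[k Kk yE] /= yM] /= <-].
have := yN _ yM; rewrite ler_norml => /andP[_]; apply: le_trans.
by rewrite yE dualD// lerDl yspos.
Qed.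

(** The difference quotients of a convex function on the segment from [w0] to [w]
    are at most [phi w - phi w0], and they are at least [ws (w - w0)] for a
    subgradient [ws]. In the limit the first bound says that the differential is
    a subgradient; the second says that [ws] is below the differential, and
    comparable linear functionals are equal. *)
Lemma subdifferential_differentiable (R : realType) (W Y : normedModType R)
    (f : W -> Y) (ys : Y -> R^o) (w0 : W) :
  dual ys -> differentiable f w0 ->
  convex_function (setT : set (convex_lmodType W)) (ys \o f) ->
  subdifferential (ys \o f) w0 = [set ys \o 'd f w0].
Proof.
move=> dys df /convex_functionE cphi.
have [L LE cL] := dual_linear_ex dys.
have cvgd h : t^-1 * (ys (f (t *: h + w0)) - ys (f w0)) @[t --> 0^'+] -->
    ys ('d f w0 h).
  have dLf : differentiable (L \o f) w0.
    by apply: differentiable_comp => //; exact: linear_differentiable.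
  apply: cvg_dnbhs_at_right.
  have := diff_derivable (v := h) dLf; rewrite /derivable.
  rewrite -LE => /cvg_ex[l dl].
  suff <- : l = L ('d f w0 h) by exact: dl.
  have -> : L ('d f w0 h) = 'D_h (L \o f) w0.
    rewrite deriveE// (diff_comp (g := L))//; last exact: linear_differentiable.
    by rewrite diff_lin.
  by apply/esym/cvg_lim.
apply/seteqP; split=> [ws [dws le]|_ ->].
  have {}le h : ws h <= ys ('d f w0 h).
    apply: cvgr_to_ge (cvgd h) _; near=> t.
    have t0 : 0 < t by [].
    rewrite -(ler_pM2l t0) mulrA divff ?gt_eqF// mul1r.
    by have := le (t *: h + w0); rewrite addrK dualZ.
  apply/funext => h; apply/eqP; rewrite eq_le le /=.
  by have := le (- h); rewrite linearN !dualN// lerN2.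
split; first exact: dual_comp (diff_continuous df) dys.
move=> w /=; apply: cvgr_to_le (cvgd _) _; near=> t.
have t0 : 0 < t by [].
have t1 : t <= 1 by near: t; apply: nbhs_right_le.
rewrite -(ler_pM2l t0) mulrA divff ?gt_eqF// mul1r.
have := cphi t w w0 (ltW t0) t1; rewrite /=.
have -> : t *: w + (1 - t) *: w0 = t *: (w - w0) + w0.
  by rewrite scalerBl scale1r scalerBr addrA addrAC.
lra.
Unshelve. all: by end_near.
Qed.

(** * The coderivative of the objective map *)

Lemma differential_pair (R : realType) (P X Y : normedModType R)
    (f : P * X -> Y) p x : differentiable f (p, x) ->
  ('d (fun p' => f (p', x)) p = (fun h => 'd f (p, x) (h, 0)) :> (P -> Y)) /\
  ('d (fun x' => f (p, x')) x = (fun h => 'd f (p, x) (0, h)) :> (X -> Y)).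
Proof.
move=> df.
have dp : is_diff p (fun p' : P => (p', x)) (fun h => (h, 0)).
  exact: is_diff_pair.
have dx : is_diff x (fun x' : X => (p, x')) (fun h => (0, h)).
  exact: is_diff_pair.
have [dfp dfpE] := dp; have [dfx dfxE] := dx.
split.
  have -> : (fun p' => f (p', x)) = f \o (fun p' => (p', x)) by [].
  by rewrite diff_comp// dfpE.
have -> : (fun x' => f (p, x')) = f \o (fun x' => (p, x')) by [].
by rewrite diff_comp// dfxE.
Qed.

Lemma subdifferential_sub_dual (R : realType) (W : normedModType R)
    (phi : W -> R) (us : W -> R^o) w0 (ws : W -> R^o) : dual us ->
  subdifferential (fun w => phi w - us w) w0 ws ->
  subdifferential phi w0 (us + ws).
Proof.
move=> dus [dws le]; split=> [|w]; first exact: dual_add.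
have := le w; rewrite !fctE (dualB _ _ dus); lra.
Qed.

(** For the nontrivial inclusion, [us] in the left-hand side means that
    [(p0, x0)] minimizes [ys (f (p, x)) - us p] over the graph of [C]. A
    multiplier [l] for this problem, with partial functionals [l1] and [l2],
    yields the subgradient [(us + l1, l2)] of [ys \o f] and the element [- l1]
    of the coderivative of [C] at [l2]; they add up to [us]. *)
Lemma coderivative_objective (R : realType) (P X Y : completeNormedModType R)
    (K : set Y) (f : P * X -> Y) (C : P -> set X) p0 x0 (ys : Y -> R^o) :
  K 0 -> K_convex K (singleton_map f) -> K_closed K (singleton_map f) ->
  convex_map C -> C p0 x0 -> dual_cone K ys ->
  coderivative (profile K (objective_map f C)) (p0, f (p0, x0)) ys =
    \bigcup_(q in as_pairs (subdifferential (ys \o f) (p0, x0)))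
      [set q.1 + r | r in coderivative C (p0, x0) q.2].
Proof.
move=> K0 cf clf cC Cpx ysK; have [dys yspos] := ysK.
have Fpx : objective_map f C p0 (f (p0, x0)) by exists x0.
apply/seteqP; split=> [us /(coderivative_profileE us dys K0 Fpx)[dus _ le]|].
  pose us' : P * X -> R^o := pair_functional us 0.
  have dus' : dual us'.
    apply: dual_pair => //; split=> [a x y|x]; last exact: cvg_cst.
    by rewrite /= scaler0 addr0.
  have us'E w : us' w = us w.1 by rewrite /us' /pair_functional addr0.
  pose phi w := ys (f w) - us' w.
  have cphi : convex_function (setT : set (convex_lmodType (P * X)%type)) phi.
    have /convex_functionE cysf := scalarization_convex ysK K0 cf.
    apply/convex_functionE => t x y t0 t1.
    rewrite /phi (dualD _ _ dus') !(dualZ _ _ dus').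
    by have := cysf t x y t0 t1; rewrite /=; lra.
  have [M [r [r0 ysfM]]] := scalarization_locally_bounded ysK K0 cf clf (p0, x0).
  have [N usN] := dual_bounded (`|(p0, x0)| + r) dus'.
  have phiM w : ball (p0, x0) r w -> phi w <= M + N.
    move=> wr; have := wr; rewrite -ball_normE /= => /ltW w0w.
    have /usN : `|w| <= `|(p0, x0)| + r.
      rewrite -[w](subKr (p0, x0)) (le_trans (ler_normB _ _))//.
      by rewrite lerD2l.
    rewrite ler_norml => /andP[usw _].
    by have := ysfM w wr; rewrite /phi /=; lra.
  have phimin w : svgph C w -> phi (p0, x0) <= phi w.
    case: w => p x Cw; have := le p (f (p, x)).
    rewrite (dualB _ _ dus) (dualB _ _ dys) /phi.
    by rewrite !us'E => /(_ (ex_intro2 _ _ x Cw erefl)); lra.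
  have [l [sl lC]] :=
    @constrained_minimizer_multiplier _ _ _ (svgph C) (p0, x0) _ _
      cphi cC Cpx r0 phiM phimin.
  have [dl _] := sl; have [dl1 dl2] := (dual_inl dl, dual_inr dl).
  have lE w : l w = l (w.1, 0) + l (0, w.2).
    by rewrite -[in LHS](pair_functionalK dl).
  exists (us + (fun p => l (p, 0)), fun x => l (0, x)) => /=.
    split=> //=; first exact: dual_add.
    have -> : pair_functional (us + fun p => l (p, 0)) (fun x => l (0, x)) =
        us' + l.
      apply/funext => w.
      change (us w.1 + l (w.1, 0) + l (0, w.2) = us' w + l w).
      by rewrite us'E (lE w) addrA.
    exact: subdifferential_sub_dual.
  exists (- (fun p => l (p, 0))); last by apply/funext => p; rewrite !fctE addrK.
  split; first exact: dual_opp.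
  split; first by apply: dual_pair; exact: dual_opp.
  move=> w Cw; have := lC w Cw; rewrite lE -oppr_le0 opprD.
  exact.
move=> _ [q [dq1 dq2 [_ sub]] [r [dr [_ nc]] <-]].
apply/coderivative_profileE => //; split=> //; first exact: dual_add.
move=> p _ [x Cx ->]; have := sub (p, x); have := nc (p, x) Cx.
rewrite /pair_functional/= !fctE (dualB _ _ dys).
lra.
Qed.

Theorem theorem1 (R : realType) (P X Y : completeNormedModType R)
    (K : set Y) (f : P * X -> Y) (C : P -> set X) (pbar : P) (xbar : X) :
  pointed_closed_convex_cone K ->
  K_convex K (singleton_map f) -> K_closed K (singleton_map f) ->
  proper_map C -> closed_map C -> convex_map C ->
  svgph (solution_map K f C) (pbar, xbar) ->
  closed_subspace
    (cone (set_sub (svrge (graph_map C)) (svdom (singleton_map f)))) ->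
  closed_subspace (cone (set_sub [set: P] (svdom C))) ->
  let ybar := f (pbar, xbar) in
  let DFK := coderivative (profile K (objective_map f C)) (pbar, ybar) in
  let DfK := coderivative (profile K (singleton_map f)) ((pbar, xbar), ybar) in
  let DC := coderivative C (pbar, xbar) in
  [/\ (forall ys, dual ys ->
         DFK ys = \bigcup_(q in as_pairs (DfK ys))
                    [set q.1 + r | r in DC q.2]),
      (forall ys, dual_cone K ys ->
         DFK ys = \bigcup_(q in as_pairs (subdifferential (ys \o f)
                                            (pbar, xbar)))
                    [set q.1 + r | r in DC q.2]) &
      (continuously_differentiable_at f (pbar, xbar) ->
       forall ys, dual_cone K ys ->
         DFK ys =
           [set adjoint ('d (fun p => f (p, xbar)) pbar) ys + r
              | r in DC (adjoint ('d (fun x => f (pbar, x)) xbar) ys)])].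
Proof.
move=> [[k Kk] Kcone _ _ _] cf clf _ _ cC [Cpx _] _ _ ybar DFK DfK DC.
have K0 : K 0 by rewrite -(scale0r k); exact: Kcone.
have fpx : singleton_map f (pbar, xbar) ybar by [].
have Fpx : objective_map f C pbar ybar by exists xbar.
have part2 ys : dual_cone K ys ->
    DFK ys = \bigcup_(q in as_pairs (subdifferential (ys \o f) (pbar, xbar)))
               [set q.1 + r | r in DC q.2].
  by move=> ysK; exact: coderivative_objective.
split=> // [ys dys|[/nbhs_singleton df _] ys ysK].
- have [ysK|nysK] := pselect (dual_cone K ys).
    rewrite part2//; congr (\bigcup_(q in as_pairs _) _).
    apply/seteqP; split=> [us [dus le]|us].
      apply/(coderivative_profileE _ dys K0 fpx); split=> //; first by case: ysK.
      by move=> w _ ->; rewrite (dualB _ _ dys); exact: le.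
    move=> /(coderivative_profileE _ dys K0 fpx)[dus _ le]; split=> // w.
    have := le w (f w) erefl; rewrite /ybar (dualB _ _ dys).
    exact.
  (* Outside the dual cone both sides are empty. *)
  apply/seteqP; split=> [us /(coderivative_profileE _ dys K0 Fpx)[_ ys0 _]|us].
    by case: nysK.
  by move=> [q [_ _ /(coderivative_profileE _ dys K0 fpx)[_ ys0 _]]]; case: nysK.
- have [dys _] := ysK.
  have [dfp dfx] := differential_pair df.
  have dysdf : dual (ys \o 'd f (pbar, xbar)).
    exact: dual_comp (diff_continuous df) dys.
  rewrite part2// subdifferential_differentiable//; last first.
    exact: (scalarization_convex ysK).
  rewrite /adjoint dfp dfx; apply/seteqP; split=> us.
    move=> [[q1 q2] [/= dq1 dq2 qE] [r DCr <-]]; exists r => //.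
      suff -> : ys \o (fun h => 'd f (pbar, xbar) (0, h)) = q2 by [].
      apply/funext => h; have := congr1 (@^~ (0, h)) qE.
      by rewrite /pair_functional /= dual0// add0r.
    congr (_ + _); apply/funext => h; have := congr1 (@^~ (h, 0)) qE.
    by rewrite /pair_functional /= (dual0 dq2) addr0.
  move=> [r DCr <-].
  exists (fun h => ys ('d f (pbar, xbar) (h, 0)),
          fun h => ys ('d f (pbar, xbar) (0, h))).
    split; [exact: dual_inl dysdf|exact: dual_inr dysdf|].
    exact: pair_functionalK dysdf.
  by exists r.
Qed.
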